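(* Let $n_i, c_i$ ($i=1,2$) be integers with $0 \le c_i \le n_i$ and $c_1 \le c_2$. Let $f_1, f_2 : \mathbb{R} \to \mathbb{R}$ be continuous piecewise-linear functions with $n(f_i) = n_i$ and $c(f_i) = c_i$, and let $f_0 = \min\{f_1, f_2\}$ be their lower envelope. Then $$n(f_0) \le n_1 + n_2 + 1 + \min\{2c_1 + n_2 - c_2 + 1,\; c_1 + c_2\}, \qquad c(f_0) \le c_1 + c_2,$$ and these estimates are tight.
   Context: For a piecewise-linear function $f:\mathbb{R}\to\mathbb{R}$, $n(f)$ denotes the total number of vertices of its graph, $c(f)$ the number of convex vertices, and $r(f)=n(f)-c(f)$ the number of concave (reflex) vertices. The lower envelope of $f_1,f_2$ is the pointwise minimum $f_0(x)=\min\{f_1(x),f_2(x)\}$. *)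

(* Defs.v *)
From mathcomp Require Import all_boot all_order all_algebra finmap.
From mathcomp Require Import boolp classical_sets functions cardinality reals.
From mathcomp Require Import topology normedtype.
Set Implicit Arguments.
Unset Strict Implicit.
Unset Printing Implicit Defensive.
Import Order.TTheory GRing.Theory Num.Theory.
Import numFieldNormedType.Exports.
Local Open Scope classical_set_scope.
Local Open Scope ring_scope.

Section PiecewiseLinear.
Variable R : realType.
Implicit Types (f : R -> R) (x l r : R).

(* [s] is a finite list of breakpoints, possibly redundant and in any order;
   [i] may be unbounded, so the two end pieces are affine on whole rays. *)
Definition piecewise_linear f : Prop :=
  exists s : seq R, forall i : interval R,
    (forall t, t \in s -> t \notin i) ->
    exists a b : R, forall x, x \in i -> f x = a * x + b.

(* At [x], the graph of [f] has slope [l] to the left and [r] to the right. *)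
Definition slopes_at f x l r : Prop :=
  (\forall y \near x^'-, f y = f x + l * (y - x)) /\
  (\forall y \near x^'+, f y = f x + r * (y - x)).

(* Vertices are identified with their abscissae; a breakpoint at which the slope
   does not change is not a vertex. *)
Definition vertices f : set R :=
  [set x | exists l r, slopes_at f x l r /\ l != r].

Definition convex_vertices f : set R :=
  [set x | exists l r, slopes_at f x l r /\ l < r].

(* [fset_set] sends infinite sets to the empty set; by [finite_vertices] below
   this case does not arise for piecewise-linear functions. *)
Definition n_vertices f : nat := #|` fset_set (vertices f)|.

Definition n_convex f : nat := #|` fset_set (convex_vertices f)|.

Lemma convex_vertices_sub f : convex_vertices f `<=` vertices f.
Proof. by move=> x [l [r [h lr]]]; exists l, r; rewrite lt_eqF. Qed.

Lemma finite_vertices f : piecewise_linear f -> finite_set (vertices f).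
Proof.
move=> [s hs]; apply: (@sub_finite_set _ _ [set` s]); last exact: finite_seq.
move=> x [l [r [[hl hr] lr]]] /=; apply: contraT => xs.
have [e e0 he] : exists2 e, 0 < e & forall t, t \in s -> e <= `|x - t|.
  elim: s xs {hs} => [|t s ih]; first by exists 1.
  rewrite inE negb_or => /andP[xt /ih [e e0 he]].
  exists (Num.min e `|x - t|) => [|u].
    by rewrite lt_min e0 normr_gt0 subr_eq0.
  rewrite inE ge_min => /predU1P[->|/he ->//]; first by rewrite lexx orbT.
have [|a [b fab]] := hs `]x - e, x + e[.
  by move=> t /he; rewrite in_itv /= -ltr_distlC distrC -leNgt.
have fx : f x = a * x + b.
  by apply: fab; rewrite in_itv /= ltrBlDr ltrDl e0.
have la : l = a.
  near (x^'-) => y.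
  have yx : y < x by near: y; exact: nbhs_left_lt.
  have fy : f y = f x + l * (y - x) by near: y.
  apply: (@mulIf _ (y - x)); first by rewrite subr_eq0 lt_eqF.
  apply: (@addrI _ (f x)); rewrite -fy fx fab.
    by rewrite mulrBr [RHS]addrC addrA subrK.
  rewrite in_itv /= (lt_trans yx) ?ltrDl // andbT.
  by near: y; apply: nbhs_left_gt; rewrite ltrBlDr ltrDl.
have ra : r = a.
  near (x^'+) => y.
  have xy : x < y by near: y; exact: nbhs_right_gt.
  have fy : f y = f x + r * (y - x) by near: y.
  apply: (@mulIf _ (y - x)); first by rewrite subr_eq0 gt_eqF.
  apply: (@addrI _ (f x)); rewrite -fy fx fab.
    by rewrite mulrBr [RHS]addrC addrA subrK.
  rewrite in_itv /= (lt_trans _ xy) ?ltrBlDr ?ltrDl //=.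
  by near: y; apply: nbhs_right_lt; rewrite ltrDl.
by rewrite la ra eqxx in lr.
Unshelve. all: by end_near.
Qed.

End PiecewiseLinear.

(* Main.v *)
(** Both upper bounds come from sweeping the line from left to right with an
  amortised count.  Write [d = f1 - f2].  A crossing can only occur when [d] is
  heading towards [0] ("armed"); after a crossing [d] moves away from [0], and
  re-arming requires a convex vertex of the lower function or a reflex vertex of
  the upper one.  A credit that depends only on the germs of [f1] and [f2] on one
  side of a point turns this into an inequality at each single point, and
  summing over all breakpoints telescopes.

  For tightness the two functions are grown at [+oo], where the gap between them
  increases, by bending one of them: each bend may be chosen so that it is
  visible, or so that the functions cross once more, or both.  The grown pairs
  only need enough vertices, because the upper bounds give the equalities. *)

Require Import Defs.
From mathcomp Require Import all_boot all_order all_algebra finmap.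
From mathcomp Require Import boolp classical_sets functions cardinality reals.
From mathcomp Require Import topology normedtype.
From mathcomp Require Import zify ring lra.
Set Implicit Arguments.
Unset Strict Implicit.
Unset Printing Implicit Defensive.
Import Order.TTheory GRing.Theory Num.Theory.
Import numFieldNormedType.Exports.
Local Open Scope ring_scope.

(** * One-sided slopes of continuous piecewise-linear functions *)

Section Slopes.
Variable R : realType.
Implicit Types (f g : R -> R) (x l r : R) (s : seq R).

Lemma slopes_at_uniq f x l r l' r' :
  slopes_at f x l r -> slopes_at f x l' r' -> l = l' /\ r = r'.
Proof.
move=> [hl hr] [hl' hr']; split.
- near (x^'-)%classic => y.
  have yx : y < x by near: y; exact: nbhs_left_lt.
  have e1 : f y = f x + l * (y - x) by near: y.
  have e2 : f y = f x + l' * (y - x) by near: y.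
  apply: (@mulIf _ (y - x)); first by rewrite subr_eq0 lt_eqF.
  by apply: (@addrI _ (f x)); rewrite -e1 -e2.
- near (x^'+)%classic => y.
  have yx : x < y by near: y; exact: nbhs_right_gt.
  have e1 : f y = f x + r * (y - x) by near: y.
  have e2 : f y = f x + r' * (y - x) by near: y.
  apply: (@mulIf _ (y - x)); first by rewrite subr_eq0 gt_eqF.
  by apply: (@addrI _ (f x)); rewrite -e1 -e2.
Unshelve. all: by end_near. Qed.

(** [get] makes the pair of slopes a total function; by [cpl_slopes] it is the genuine pair whenever
    [f] is continuous and piecewise linear. *)
Definition slopes f x : R * R := get [set p | slopes_at f x p.1 p.2]%classic.
Definition lslope f x := (slopes f x).1.
Definition rslope f x := (slopes f x).2.

Lemma slopesE f x l r : slopes_at f x l r -> lslope f x = l /\ rslope f x = r.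
Proof.
move=> h; apply: (@slopes_at_uniq f x _ _ _ _ _ h).
by apply: (@getPex _ [set p | slopes_at f x p.1 p.2]%classic); exists (l, r).
Qed.

Lemma slopes_at_ext f g x y z l r : y < x < z -> {in `]y, z[, f =1 g} ->
  slopes_at f x l r -> slopes_at g x l r.
Proof.
move=> /andP[yx xz] fg [hl hr].
have fgx : f x = g x by apply: fg; rewrite in_itv /= yx.
split; near=> t.
- rewrite -fgx -fg; first by near: t.
  rewrite in_itv /=; apply/andP; split; first by near: t; exact: nbhs_left_gt.
  by apply: lt_trans xz; near: t; exact: nbhs_left_lt.
- rewrite -fgx -fg; first by near: t.
  rewrite in_itv /=; apply/andP; split; last by near: t; exact: nbhs_right_lt.
  by apply: lt_trans yx _; near: t; exact: nbhs_right_gt.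
Unshelve. all: by end_near. Qed.

Lemma affine_at_left f x y a b : continuous f -> y < x ->
  {in `]y, x[, forall t, f t = a * t + b} -> f x = a * x + b.
Proof.
move=> cf yx h.
have c1 : (f t @[t --> x^'-] --> f x)%classic by apply: cvg_at_left_filter; exact: cf.
have c2 : (f t @[t --> x^'-] --> a * x + b)%classic.
  have : (a * t + b @[t --> x^'-] --> a * x + b)%classic.
    apply: cvg_at_left_filter; apply: cvgD; last exact: cvg_cst.
    by apply: cvgM; [exact: cvg_cst|exact: cvg_id].
  apply: cvg_trans; apply: near_eq_cvg; near=> t.
  rewrite h // in_itv /=; apply/andP; split; near: t.
    exact: nbhs_left_gt.
  exact: nbhs_left_lt.
exact: (cvg_unique _ c1 c2).
Unshelve. all: by end_near. Qed.

Lemma affine_at_right f x y a b : continuous f -> x < y ->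
  {in `]x, y[, forall t, f t = a * t + b} -> f x = a * x + b.
Proof.
move=> cf yx h.
have c1 : (f t @[t --> x^'+] --> f x)%classic by apply: cvg_at_right_filter; exact: cf.
have c2 : (f t @[t --> x^'+] --> a * x + b)%classic.
  have : (a * t + b @[t --> x^'+] --> a * x + b)%classic.
    apply: cvg_at_right_filter; apply: cvgD; last exact: cvg_cst.
    by apply: cvgM; [exact: cvg_cst|exact: cvg_id].
  apply: cvg_trans; apply: near_eq_cvg; near=> t.
  rewrite h // in_itv /=; apply/andP; split; near: t.
    exact: nbhs_right_gt.
  exact: nbhs_right_lt.
exact: (cvg_unique _ c1 c2).
Unshelve. all: by end_near. Qed.

Lemma slopes_at_affine f x y z a b a' b' : continuous f -> y < x < z ->
  {in `]y, x[, forall t, f t = a * t + b} ->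
  {in `]x, z[, forall t, f t = a' * t + b'} ->
  slopes_at f x a a'.
Proof.
move=> cf /andP[yx xz] h h'; split; near=> t.
- rewrite (affine_at_left cf yx h) h ?in_itv /=; first by ring.
  apply/andP; split; near: t.
    exact: nbhs_left_gt.
  exact: nbhs_left_lt.
- rewrite (affine_at_right cf xz h') h' ?in_itv /=; first by ring.
  apply/andP; split; near: t.
    exact: nbhs_right_gt.
  exact: nbhs_right_lt.
Unshelve. all: by end_near. Qed.

Definition cpl f := continuous f /\ piecewise_linear f.

Lemma seq_gap s x :
  exists2 e, 0 < e & forall t, t \in s -> t != x -> e <= `|x - t|.
Proof.
elim: s => [|t s [e e0 he]]; first by exists 1.
have [->|tx] := eqVneq t x.
  by exists e => // u; rewrite inE => /predU1P[->|/he //]; rewrite eqxx.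
exists (Num.min e `|x - t|) => [|u].
  by rewrite lt_min e0 normr_gt0 subr_eq0 eq_sym.
rewrite inE ge_min => /predU1P[->|/he h /h ->//]; by rewrite lexx orbT.
Qed.

Lemma cpl_slopes f x : cpl f -> slopes_at f x (lslope f x) (rslope f x).
Proof.
move=> [cf [s hs]].
suff [l [r h]] : exists l r, slopes_at f x l r.
  by have [-> ->] := slopesE h.
(* Within distance [e] of [x] the only possible breakpoint is [x] itself, so [f] is affine on each
   side. *)
have [e e0 he] := seq_gap s x.
have [|a [b hab]] := hs `]x - e, x[.
  move=> t /he; rewrite in_itv /= => h; apply/negP => /andP[h1 h2].
  have := h; rewrite lt_eqF // => /(_ isT); rewrite gtr0_norm ?subr_gt0 //; lra.
have [|a' [b' hab']] := hs `]x, x + e[.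
  move=> t /he; rewrite in_itv /= => h; apply/negP => /andP[h1 h2].
  have := h; rewrite gt_eqF // => /(_ isT); rewrite ltr0_norm ?subr_lt0 //; lra.
exists a, a'; apply: (slopes_at_affine cf _ hab hab'); apply/andP; split; lra.
Qed.

Lemma verticesE f x l r : slopes_at f x l r -> vertices f x <-> l != r.
Proof.
move=> h; split=> [[l' [r' [h' lr]]]|lr]; last by exists l, r.
by have [-> ->] := slopes_at_uniq h h'.
Qed.

Lemma convex_verticesE f x l r :
  slopes_at f x l r -> convex_vertices f x <-> l < r.
Proof.
move=> h; split=> [[l' [r' [h' lr]]]|lr]; last by exists l, r.
by have [-> ->] := slopes_at_uniq h h'.
Qed.

End Slopes.

(** * Slopes of the lower envelope *)

Section Envelope.
Variable R : realType.
Implicit Types (f g : R -> R) (x l r : R) (s : seq R).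

(** Here [d] stands for [f1 x - f2 x]. At a tie the left slope is the maximum, since to the left of
    the point the steeper function is the smaller one. *)
Definition env_left (d l1 l2 : R) :=
  if d < 0 then l1 else if 0 < d then l2 else Num.max l1 l2.

Definition env_right (d r1 r2 : R) :=
  if d < 0 then r1 else if 0 < d then r2 else Num.min r1 r2.

Lemma continuous_near_lt f g x : continuous f -> continuous g -> f x < g x ->
  \forall y \near x, f y < g y.
Proof.
move=> cf cg fg; near=> y.
have h1 : f y < (f x + g x) / 2.
  by near: y; apply: (cvgr_lt (f x)); [exact: cf|lra].
have h2 : (f x + g x) / 2 < g y.
  by near: y; apply: (cvgr_gt (g x)); [exact: cg|lra].
exact: lt_trans h2.
Unshelve. all: by end_near. Qed.

Lemma slopes_at_near_eq f g x l r : (\forall y \near x, f y = g y) ->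
  slopes_at f x l r -> slopes_at g x l r.
Proof.
move=> fg [hl hr]; have fgx := nbhs_singleton fg.
have fgl : \forall y \near (x^'-)%classic, f y = g y by exact: cvg_within.
have fgr : \forall y \near (x^'+)%classic, f y = g y by exact: cvg_within.
split; near=> y; rewrite -fgx -(_ : f y = g y).
all: by near: y.
Unshelve. all: by end_near. Qed.

Lemma slopes_at_min f1 f2 x l1 r1 l2 r2 : continuous f1 -> continuous f2 ->
  slopes_at f1 x l1 r1 -> slopes_at f2 x l2 r2 ->
  slopes_at (f1 \min f2) x
    (env_left (f1 x - f2 x) l1 l2) (env_right (f1 x - f2 x) r1 r2).
Proof.
move=> c1 c2 h1 h2; rewrite /env_left /env_right subr_lt0 subr_gt0.
case: ltgtP => [lt12|lt21|e12].
- apply: slopes_at_near_eq h1; near=> y => /=; rewrite min_l // ltW //.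
  by near: y; exact: continuous_near_lt.
- apply: slopes_at_near_eq h2; near=> y => /=; rewrite min_r // ltW //.
  by near: y; exact: continuous_near_lt.
move: h1 h2 => [hl1 hr1] [hl2 hr2]; split; near=> y => /=.
- have yx : y < x by near: y; exact: nbhs_left_lt.
  rewrite (_ : f1 y = f1 x + l1 * (y - x)); last by near: y.
  rewrite (_ : f2 y = f2 x + l2 * (y - x)); last by near: y.
  by rewrite -e12 minxx; case: leP => ?; case: leP => ?; nra.
- have yx : x < y by near: y; exact: nbhs_right_gt.
  rewrite (_ : f1 y = f1 x + r1 * (y - x)); last by near: y.
  rewrite (_ : f2 y = f2 x + r2 * (y - x)); last by near: y.
  by rewrite -e12 minxx; case: leP => ?; case: leP => ?; nra.
Unshelve. all: by end_near. Qed.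

End Envelope.

(** * Counting lemmas and the amortised sweep *)

Lemma count_lt (T : eqType) (p q : pred T) (s : seq T) (x : T) :
  subpred p q -> x \in s -> q x -> ~~ p x -> (count p s < count q s)%N.
Proof.
move=> pq xs qx px; elim: s xs => //= y s ih; rewrite inE => /predU1P[<-|/ih].
  by rewrite qx (negPf px) ltnS sub_count.
by have := pq y; case: (p y) => [->//|_]; case: (q y) => //=; lia.
Qed.

(** Writing all vertex counts as sums over one common list allows them to be compared point by
    point. *)
Lemma card_fset_set_sum (T : choiceType) (A : set T) (P : pred T) (s : seq T) :
  uniq s -> (forall x, A x <-> P x) -> (forall x, A x -> x \in s) ->
  #|` fset_set A| = (\sum_(x <- s) P x)%N.
Proof.
move=> us AP As.
have -> : fset_set A = [fset x in seq.filter P s]%fset.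
  have fA : finite_set A by apply: sub_finite_set As _; exact: finite_seq.
  apply/fsetP => x; rewrite in_fset_set // !inE /= mem_filter.
  apply/idP/andP => [|[Px _]]; last by rewrite inE; apply/AP.
  by rewrite inE => Ax; split; [apply/AP|exact: As].
rewrite card_fseq undup_id ?seq.filter_uniq // size_filter.
by rewrite -sum1_count big_mkcond /=; apply: eq_bigr => x _; case: (P x).
Qed.

(** The credit leaving each point is the credit entering the next, so the local inequalities
    telescope; only the initial credit, at most [K], is left over. *)
Lemma sweep (T : Type) (cost budget credL credR : T -> nat) (s : seq T) (K : nat) :
  sorted (fun x y => credR x == credL y) s ->
  (forall x, cost x + credR x <= credL x + budget x)%N ->
  (forall x, credL x <= K)%N ->
  (\sum_(x <- s) cost x <= \sum_(x <- s) budget x + K)%N.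
Proof.
move=> hs hloc hK; case: s hs => [|x s]; first by rewrite !big_nil.
move=> /= hp; apply: (@leq_trans (\sum_(y <- x :: s) budget y + credL x)); last first.
  by rewrite leq_add2l.
elim: s x hp => [x _|y s ih x /= /andP[/eqP xy /ih {}ih]].
  by rewrite !big_seq1; have := hloc x; lia.
by rewrite big_cons [X in (_ <= X + _)%N]big_cons; have := hloc x; lia.
Qed.

(** * Breakpoint lists and finiteness of the envelope's vertices *)

Section Breakpoints.
Variable R : realType.
Implicit Types (f g : R -> R) (x l r : R) (s : seq R).

Lemma gap_slopes f x y a b : cpl f -> x < y ->
  {in `]x, y[, forall t, f t = a * t + b} ->
  [/\ rslope f x = a, lslope f y = a, f x = a * x + b & f y = a * y + b].
Proof.
move=> hf xy h; have fx := affine_at_right hf.1 xy h.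
have fy := affine_at_left hf.1 xy h.
split => //.
- have [_ hr] := cpl_slopes x hf; near (x^'+)%classic => t.
  have xt : x < t by near: t; exact: nbhs_right_gt.
  have ty : t < y by near: t; exact: nbhs_right_lt.
  have e : f t = f x + rslope f x * (t - x) by near: t.
  apply: (@mulIf _ (t - x)); first by rewrite subr_eq0 gt_eqF.
  by apply: (@addrI _ (f x)); rewrite -e fx h ?in_itv /= ?xt //; ring.
- have [hl _] := cpl_slopes y hf; near (y^'-)%classic => t.
  have xt : x < t by near: t; exact: nbhs_left_gt.
  have ty : t < y by near: t; exact: nbhs_left_lt.
  have e : f t = f y + lslope f y * (t - y) by near: t.
  apply: (@mulIf _ (t - y)); first by rewrite subr_eq0 lt_eqF.
  by apply: (@addrI _ (f y)); rewrite -e fy h ?in_itv /= ?xt //; ring.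
Unshelve. all: by end_near. Qed.

(** Both clauses survive enlarging [s], so that one list can serve several functions. *)
Definition breakpoints f s :=
  (forall x y, (forall t, t \in s -> t \notin `]x, y[) ->
     exists a b, {in `]x, y[, forall t, f t = a * t + b}) /\
  (forall x, vertices f x -> x \in s).

Lemma breakpoints_exist f : cpl f -> exists s, breakpoints f s.
Proof.
move=> [_ hf]; have /finite_seqP[v hv] := finite_vertices hf.
case: hf => s hs; exists (s ++ v); split=> [x y h|x].
  by apply: hs => t ts; apply: h; rewrite mem_cat ts.
by rewrite hv mem_cat => /= ->; rewrite orbT.
Qed.

Lemma breakpoints_sub f s s' : {subset s <= s'} ->
  breakpoints f s -> breakpoints f s'.
Proof.
move=> ss' [h1 h2]; split=> [x y h|x /h2 /ss' //].
by apply: h1 => t /ss'; exact: h.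
Qed.

Lemma env_vertex f1 f2 x : cpl f1 -> cpl f2 ->
  vertices (f1 \min f2) x <->
  env_left (f1 x - f2 x) (lslope f1 x) (lslope f2 x) !=
  env_right (f1 x - f2 x) (rslope f1 x) (rslope f2 x).
Proof.
move=> h1 h2; apply: verticesE.
exact: (slopes_at_min h1.1 h2.1 (cpl_slopes x h1) (cpl_slopes x h2)).
Qed.

Lemma not_vertex f x : cpl f -> ~ vertices f x -> lslope f x = rslope f x.
Proof.
by move=> hf hv; apply/eqP/negPn/negP => /(verticesE (cpl_slopes x hf)).
Qed.

(** Without a tie the envelope agrees locally with one of the functions, which has no vertex there;
    at a tie with equal slopes, maximum and minimum coincide. *)
Lemma env_crossing f1 f2 x : cpl f1 -> cpl f2 ->
  ~ vertices f1 x -> ~ vertices f2 x -> vertices (f1 \min f2) x ->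
  f1 x = f2 x /\ rslope f1 x != rslope f2 x.
Proof.
move=> h1 h2 v1 v2 /(env_vertex _ h1 h2).
rewrite (not_vertex h1 v1) (not_vertex h2 v2) /env_left /env_right.
case: ltgtP => e; rewrite ?eqxx // => ne; split; first lra.
by apply: contraNneq ne => ->; rewrite maxxx minxx.
Qed.

(** Outside the breakpoints a vertex of the envelope is a transversal crossing, and each gap holds
    at most one because [f1 - f2] is affine there. *)
Lemma finite_env_vertices f1 f2 : cpl f1 -> cpl f2 ->
  finite_set (vertices (f1 \min f2)).
Proof.
move=> h1 h2; have [s1 hs1] := breakpoints_exist h1.
have [s2 hs2] := breakpoints_exist h2.
pose s := s1 ++ s2.
have {}hs1 : breakpoints f1 s.
  by apply: breakpoints_sub hs1 => t; rewrite mem_cat => ->.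
have {}hs2 : breakpoints f2 s.
  by apply: breakpoints_sub hs2 => t; rewrite mem_cat => ->; rewrite orbT.
pose C := [set x | vertices (f1 \min f2) x /\ x \notin s]%classic.
(* The number of breakpoints to the left of a crossing identifies its gap, and [g] picks the
   crossing of a given gap. *)
pose rk x := count (fun t => t < x) s.
pose g i := get [set x | C x /\ rk x = i]%classic.
apply: (@sub_finite_set _ _ ([set` s] `|` [set g i | i in `I_(size s).+1])%classic).
  move=> x hx; have [xs|xs] := boolP (x \in s); [by left|right].
  exists (rk x); first by rewrite /= ltnS count_size.
  have Cx : C x by [].
  have [Cy rky] : C (g (rk x)) /\ rk (g (rk x)) = rk x.
    by apply: (@getPex _ [set y | C y /\ rk y = rk x]%classic); exists x.
  move: (g (rk x)) Cy rky => y {hx xs}.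
  suff inj u v : C u -> C v -> rk u = rk v -> ~ u < v.
    move=> Cy e; have := inj _ _ Cx Cy (esym e); have := inj _ _ Cy Cx e.
    by case: ltgtP.
  move=> [vu us] [vv vs] e uv.
  have gap t : t \in s -> t \notin `]u, v[.
    move=> ts; rewrite in_itv /=; apply/negP => /andP[ut tv].
    suff : (rk u < rk v)%N by rewrite e ltnn.
    apply: (count_lt _ ts tv); last by rewrite -leNgt ltW.
    by move=> z zu; exact: lt_trans uv.
  have nv w f : breakpoints f s -> w \notin s -> ~ vertices f w.
    by move=> [_ hv] /negP ws /hv.
  have [a1 [b1 /(gap_slopes h1 uv) [r1 _ f1u f1v]]] := hs1.1 _ _ gap.
  have [a2 [b2 /(gap_slopes h2 uv) [r2 _ f2u f2v]]] := hs2.1 _ _ gap.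
  have [] := env_crossing h1 h2 (nv _ _ hs1 us) (nv _ _ hs2 us) vu.
  have [] := env_crossing h1 h2 (nv _ _ hs1 vs) (nv _ _ hs2 vs) vv.
  rewrite r1 r2 f1u f2u f1v f2v => ev _ eu /negP[].
  (* The affine difference vanishes at both [u] and [v], so its slope would be zero. *)
  have : (a1 - a2) * (v - u) = 0.
    transitivity ((a1 * v + b1 - (a2 * v + b2)) - (a1 * u + b1 - (a2 * u + b2))).
      by ring.
    by rewrite ev eu !subrr.
  by move/eqP; rewrite mulf_eq0 !subr_eq0 (gt_eqF uv) orbF.
rewrite finite_setU; split; first exact: finite_seq.
by apply: finite_image; exact: finite_II.
Qed.

End Breakpoints.

(** * Credits and the inequalities at a single point *)

Section Credits.
Variable R : realType.
Implicit Types d : R.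

(* The arguments are [d] at a point and the one-sided slopes of [f1], [f2] there;
   [armed] means that [d] is nonzero and moves towards [0] on the germ, when
   following it from left to right. *)
Definition armed_left d (l1 l2 : R) : bool :=
  if d < 0 then l2 < l1 else if 0 < d then l1 < l2 else l1 != l2.

Definition armed_right d (r1 r2 : R) : bool :=
  if d < 0 then r2 < r1 else if 0 < d then r1 < r2 else false.

(* On the germ the credit is [2] if [d < 0] is increasing, [0] if [d < 0] is not
   increasing, and [1] if [d >= 0]: the weights are those of the second bound,
   where each excursion [f1 < f2] brings at most two crossings. *)
Definition credit_left d (l1 l2 : R) : nat :=
  if 0 < d then 1%N else if l2 < l1 then 2%N else ~~ (d < 0).

Definition credit_right d (r1 r2 : R) : nat :=
  if d < 0 then (r2 < r1)%R.*2 else if 0 < d then 1%N else ~~ (r1 < r2).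

Ltac cmp := repeat match goal with
  | |- context [Num.max ?a ?b] => case: (leP a b) => ?
  | |- context [Num.min ?a ?b] => case: (leP a b) => ?
  | |- context [?a < ?b] => case: (ltgtP a b) => ?
  | |- context [?a == ?b] => case: (ltgtP a b) => ?
  end => //=; try (exfalso; lra).

(** At a tie, a maximum of left slopes below a minimum of right slopes forces both functions to be
    convex; elsewhere the lower function decides. *)
Lemma convex_local d (l1 l2 r1 r2 : R) :
  ((env_left d l1 l2 < env_right d r1 r2)%R <= (l1 < r1)%R + (l2 < r2)%R)%N.
Proof.
rewrite /env_left /env_right;
  case: (ltgtP d 0) => /= ?; cmp.
Qed.

(** Away from ties, a convex vertex of the lower function pays twice, for being visible and for
    arming; a reflex vertex of the upper one is hidden and pays for arming only. At a tie the right
    germ is never armed, and the envelope vertex is paid by the left germ or, if [l1 = l2], by a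
    vertex of [f1] or [f2]. *)
Lemma armed_local d (l1 l2 r1 r2 : R) :
  ((env_left d l1 l2 != env_right d r1 r2) + armed_right d r1 r2 <=
   armed_left d l1 l2 +
   ((l1 != r1) + (l2 != r2) + (l1 < r1)%R + (l2 < r2)%R))%N.
Proof.
rewrite /env_left /env_right /armed_left /armed_right;
  case: (ltgtP d 0) => /= ?; cmp.
Qed.

(* Convex vertices of [f2] are on the left-hand side because the bound charges
   [1] for them and [2] for the reflex ones. *)
Lemma credit_local d (l1 l2 r1 r2 : R) :
  (((env_left d l1 l2 != env_right d r1 r2) + (l2 < r2)%R) + credit_right d r1 r2 <=
   credit_left d l1 l2 +
   ((l1 != r1) + 2 * (l1 < r1)%R + 2 * (l2 != r2)))%N.
Proof.
rewrite /env_left /env_right /credit_left /credit_right;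
  case: (ltgtP d 0) => /= ?; cmp.
Qed.

(** Between adjacent breakpoints [d] is affine and keeps its sign, so both germs describe the same
    motion. The values at [d = 0] are chosen so that this persists when an endpoint is a
    crossing. *)
Lemma credit_adjacent d d' (r1 r2 e : R) : 0 < e -> d' = d + (r1 - r2) * e ->
  0 <= d * d' ->
  armed_right d r1 r2 = armed_left d' r1 r2 /\
  credit_right d r1 r2 = credit_left d' r1 r2.
Proof.
move=> e0 dE dd; rewrite /armed_right /armed_left /credit_right /credit_left.
have [r12|r12|r12] := ltgtP r1 r2.
- have h : d' < d by nra.
  by case: (ltgtP d 0) => h1; case: (ltgtP d' 0) => h2 //=; exfalso; nra.
- have h : d < d' by nra.
  by case: (ltgtP d 0) => h1; case: (ltgtP d' 0) => h2 //=; exfalso; nra.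
- have -> : d' = d by rewrite dE r12 subrr mul0r addr0.
  by case: (ltgtP d 0).
Qed.

End Credits.

(** * The upper bounds *)

Section UpperBound.
Variable R : realType.
Variables f1 f2 : R -> R.
Hypotheses (h1 : cpl f1) (h2 : cpl f2).
Let d x := f1 x - f2 x.

Definition linked x y :=
  [&& x < y, lslope f1 y == rslope f1 x, lslope f2 y == rslope f2 x,
      d y == d x + (rslope f1 x - rslope f2 x) * (y - x) & 0 <= d x * d y].

(** A strict sign change of [d] inside a gap would produce a crossing, hence a vertex of the
    envelope missing from [s]. *)
Lemma sorted_linked (s : seq R) : breakpoints f1 s -> breakpoints f2 s ->
  (forall x, vertices (f1 \min f2) x -> x \in s) ->
  sorted <%R s -> sorted linked s.
Proof.
move=> b1 b2 b0 ss; apply/(sortedP 0) => i hi.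
set x := nth 0 s i; set y := nth 0 s i.+1.
have xy : x < y by exact: (sortedP 0 ss).
have gap t : t \in s -> t \notin `]x, y[.
  move=> /(nthP 0)[j hj <-]; rewrite in_itv /=; apply/negP.
  rewrite /x /y !(lt_sorted_ltn_nth 0 ss) ?inE ?hj ?hi ?(ltnW hi) //; lia.
have [a1 [c1 e1]] := b1.1 _ _ gap; have [a2 [c2 e2]] := b2.1 _ _ gap.
have [r1 l1 f1x f1y] := gap_slopes h1 xy e1.
have [r2 l2 f2x f2y] := gap_slopes h2 xy e2.
rewrite /linked xy r1 r2 l1 l2 !eqxx /=.
have dy : d y = d x + (a1 - a2) * (y - x).
  by rewrite /d f1x f1y f2x f2y; ring.
rewrite dy eqxx /= leNgt; apply/negP => neg.
(* The zero of the affine function [d] on the gap. *)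
pose z := x - d x / (a1 - a2).
have a12 : a1 - a2 != 0.
  by apply: contraTneq neg => ->; rewrite mul0r addr0 -leNgt -expr2 sqr_ge0.
have dx : d x = (x - z) * (a1 - a2) by rewrite /z opprB addrC subrK divfK.
have xzy : x < z < y.
  have : 0 < (z - x) * (y - z) * (a1 - a2) ^+ 2.
    rewrite -oppr_lt0; congr (_ < _): neg.
    by rewrite dx; ring.
  rewrite pmulr_lgt0 ?exprn_even_gt0 // => h; apply/andP; split; nra.
have zs : z \notin s by apply/negP => /gap; rewrite in_itv /= xzy.
have [xz zy] := andP xzy.
suff : vertices (f1 \min f2) z by move/b0; rewrite (negPf zs).
have nv w f : breakpoints f s -> w \notin s -> ~ vertices f w.
  by move=> [_ hv] /negP ws /hv.
have sub : {subset `]x, z[ <= `]x, y[}.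
  by move=> t; rewrite !in_itv /= => /andP[-> /lt_trans ->].
have [_ l1z f1x' f1z] := gap_slopes h1 xz (fun t ht => e1 t (sub t ht)).
have [_ l2z f2x' f2z] := gap_slopes h2 xz (fun t ht => e2 t (sub t ht)).
apply/(env_vertex _ h1 h2).
rewrite -(not_vertex h1 (nv _ _ b1 zs)) -(not_vertex h2 (nv _ _ b2 zs)) l1z l2z.
have -> : f1 z - f2 z = 0.
  rewrite f1z f2z; transitivity (d x + (z - x) * (a1 - a2)).
    by rewrite /d f1x f2x; ring.
  by rewrite dx; ring.
rewrite /env_left /env_right ltxx; apply: contraNneq a12.
by case: (ltgtP a1 a2) => // [?|?|->]; rewrite ?subrr //; lra.
Qed.

Lemma env_breakpoints : exists s : seq R,
  [/\ uniq s, sorted linked s, forall x, vertices f1 x -> x \in s,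
      forall x, vertices f2 x -> x \in s &
      forall x, vertices (f1 \min f2) x -> x \in s].
Proof.
have [s1 b1] := breakpoints_exist h1; have [s2 b2] := breakpoints_exist h2.
have /finite_seqP[s0 b0] := finite_env_vertices h1 h2.
pose s := sort <=%R (undup (s1 ++ s2 ++ s0)).
have ms t : (t \in s) = [|| t \in s1, t \in s2 | t \in s0].
  by rewrite mem_sort mem_undup !mem_cat.
have {}b1 : breakpoints f1 s by apply: breakpoints_sub b1 => t; rewrite ms => ->.
have {}b2 : breakpoints f2 s.
  by apply: breakpoints_sub b2 => t; rewrite ms => ->; rewrite orbT.
have {}b0 x : vertices (f1 \min f2) x -> x \in s.
  by rewrite b0 ms /= => ->; rewrite !orbT.
exists s; split; [by rewrite sort_uniq undup_uniq| |exact: b1.2|exact: b2.2|by []].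
by apply: sorted_linked => //; rewrite sort_lt_sorted undup_uniq.
Qed.

Let m := f1 \min f2.

(** The last bound keeps [n_convex f2] on the left to avoid truncated subtraction. The constants [1]
    and [2] are the largest possible initial credits. *)
Lemma env_upper_bounds :
  [/\ (n_convex m <= n_convex f1 + n_convex f2)%N,
      (n_vertices m <= n_vertices f1 + n_vertices f2
                       + n_convex f1 + n_convex f2 + 1)%N &
      (n_vertices m + n_convex f2 <= n_vertices f1 + 2 * n_convex f1
                       + 2 * n_vertices f2 + 2)%N].
Proof.
have [s [us sl v1 v2 v0]] := env_breakpoints.
pose el x := env_left (d x) (lslope f1 x) (lslope f2 x).
pose er x := env_right (d x) (rslope f1 x) (rslope f2 x).
have hm x : slopes_at m x (el x) (er x).
  exact: (slopes_at_min h1.1 h2.1 (cpl_slopes x h1) (cpl_slopes x h2)).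
pose V (l r : R -> R) x : nat := l x != r x.
pose C (l r : R -> R) x : nat := l x < r x.
have nV f l r : (forall x, slopes_at f x (l x) (r x)) ->
    (forall x, vertices f x -> x \in s) ->
    n_vertices f = (\sum_(x <- s) V l r x)%N.
  move=> hf vs; apply: (card_fset_set_sum us _ vs) => x.
  exact: verticesE.
have nC f l r : (forall x, slopes_at f x (l x) (r x)) ->
    (forall x, vertices f x -> x \in s) ->
    n_convex f = (\sum_(x <- s) C l r x)%N.
  move=> hf vs; apply: (card_fset_set_sum us) => x; first exact: convex_verticesE.
  by move=> /convex_vertices_sub; exact: vs.
rewrite (nV _ _ _ hm v0) (nC _ _ _ hm v0).
rewrite (nV f1 _ _ (fun x => cpl_slopes x h1) v1).
rewrite (nV f2 _ _ (fun x => cpl_slopes x h2) v2).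
rewrite (nC f1 _ _ (fun x => cpl_slopes x h1) v1).
rewrite (nC f2 _ _ (fun x => cpl_slopes x h2) v2).
split.
- by rewrite -big_split /=; apply: leq_sum => x _; exact: convex_local.
- rewrite -!big_split /=.
  apply: (@sweep _ _ _ (fun x => armed_left (d x) (lslope f1 x) (lslope f2 x))
    (fun x => armed_right (d x) (rslope f1 x) (rslope f2 x))) => [|x|x].
  + apply: sub_sorted sl => x y /and5P[xy /eqP l1 /eqP l2 /eqP dy dxy].
    have e0 : 0 < y - x by rewrite subr_gt0.
    by rewrite l1 l2; have [-> _] := credit_adjacent e0 dy dxy.
  + exact: armed_local.
  + by case: armed_left.
- rewrite !big_distrr -!big_split /=.
  apply: (@sweep _ _ _ (fun x => credit_left (d x) (lslope f1 x) (lslope f2 x))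
    (fun x => credit_right (d x) (rslope f1 x) (rslope f2 x))) => [|x|x].
  + apply: sub_sorted sl => x y /and5P[xy /eqP l1 /eqP l2 /eqP dy dxy].
    have e0 : 0 < y - x by rewrite subr_gt0.
    by rewrite l1 l2; have [_ ->] := credit_adjacent e0 dy dxy.
  + exact: credit_local.
  + by rewrite /credit_left; do 3?case: ifP => // _; case: (_ < _).
Qed.

End UpperBound.

(** * Bending a function at one point *)

Section Bend.
Variable R : realType.
Implicit Types (f g : R -> R) (x y : R).

Lemma slopes_at_add f g x (l r l' r' : R) :
  slopes_at f x l r -> slopes_at g x l' r' ->
  slopes_at (fun y => f y + g y) x (l + l') (r + r').
Proof.
move=> [hl hr] [hl' hr']; split; near=> y.
- rewrite (_ : f y = f x + l * (y - x)); last by near: y.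
  rewrite (_ : g y = g x + l' * (y - x)); last by near: y.
  by ring.
- rewrite (_ : f y = f x + r * (y - x)); last by near: y.
  rewrite (_ : g y = g x + r' * (y - x)); last by near: y.
  by ring.
Unshelve. all: by end_near. Qed.

Definition hinge (p w x : R) : R := if x <= p then 0 else w * (x - p).

(** The form with the absolute value makes continuity immediate. *)
Lemma hingeE (p w x : R) : hinge p w x = w / 2 * (`|x - p| + (x - p)).
Proof.
rewrite /hinge; case: leP => h.
  by rewrite ler0_norm ?subr_le0 // addNr mulr0.
rewrite gtr0_norm ?subr_gt0 //; lra.
Qed.

Lemma continuous_hinge (p w : R) : continuous (hinge p w).
Proof.
move=> x; rewrite (_ : hinge p w = fun x => w / 2 * (`|x - p| + (x - p))); last first.
  by apply/funext => y; exact: hingeE.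
have h : (y - p @[y --> x] --> x - p)%classic.
  by apply: cvgB; [exact: cvg_id|exact: cvg_cst].
apply: cvgM; first exact: cvg_cst.
by apply: cvgD; [exact: cvg_norm|].
Qed.

Definition bend f (p w x : R) := f x + hinge p w x.

Lemma cpl_bend f (p w : R) : cpl f -> cpl (bend f p w).
Proof.
move=> [cf [s hs]]; split.
  by move=> x; apply: cvgD; [exact: cf|exact: continuous_hinge].
exists (p :: s) => i hi.
have [|a [b hab]] := hs i; first by move=> t ts; apply: hi; rewrite inE ts orbT.
have hp : p \notin i by apply: hi; rewrite inE eqxx.
(* An interval that avoids [p] lies entirely on one side of it. *)
have [[y yi py]|h] := pselect (exists2 y, y \in i & p < y).
  exists (a + w), (b - w * p) => x xi; rewrite /bend /hinge hab // leNgt.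
  have -> : p < x; last by rewrite /=; ring.
  rewrite ltNge; apply/negP => xp; move/negP: hp; apply.
  by apply: (@interval_is_interval _ i x y) => //; rewrite xp ltW.
exists a, b => x xi; rewrite /bend /hinge hab // leNgt.
have -> : p < x = false by apply/negP => px; apply: h; exists x.
by rewrite /= addr0.
Qed.

Lemma slopes_at_hinge (p w x : R) :
  slopes_at (hinge p w) x (if p < x then w else 0) (if p <= x then w else 0).
Proof.
have c := @continuous_hinge p w.
have lo (u v : R) : v <= p -> {in `]u, v[, forall t, hinge p w t = 0 * t + 0}.
  move=> vp t; rewrite in_itv /= /hinge => /andP[_ tv].
  by rewrite (ltW (lt_le_trans tv vp)); ring.
have hi (u v : R) : p <= u -> {in `]u, v[, forall t, hinge p w t = w * t + - w * p}.
  move=> pu t; rewrite in_itv /= /hinge => /andP[ut _].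
  by rewrite leNgt (le_lt_trans pu ut) /=; ring.
case: ltgtP => [px|xp|px].
- have e : p < x < x + 1 by apply/andP; split; lra.
  exact: (slopes_at_affine c e (hi _ _ (lexx _)) (hi _ _ (ltW px))).
- have e : x - 1 < x < p by apply/andP; split; lra.
  exact: (slopes_at_affine c e (lo _ _ (ltW xp)) (lo _ _ (lexx _))).
- have e : x - 1 < x < x + 1 by apply/andP; split; lra.
  have [h1 h2] : x <= p /\ p <= x by rewrite px.
  exact: (slopes_at_affine c e (lo _ _ h1) (hi _ _ h2)).
Qed.

Lemma slopes_at_bend f (p w x : R) : cpl f ->
  slopes_at (bend f p w) x (lslope f x + if p < x then w else 0)
                           (rslope f x + if p <= x then w else 0).
Proof.
by move=> hf; apply: slopes_at_add; [exact: cpl_slopes|exact: slopes_at_hinge].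
Qed.

(** Away from [p] the bend shifts both one-sided slopes by the same amount, so only [p] changes
    status. *)
Lemma vertices_bend f (p w : R) : cpl f -> ~ vertices f p -> w != 0 ->
  vertices (bend f p w) = (p |` vertices f)%classic.
Proof.
move=> hf vp w0; apply/seteqP; split=> x.
  move/(verticesE (slopes_at_bend p w x hf)) => h.
  have [->|xp] := eqVneq x p; [by left|right].
  apply/(verticesE (cpl_slopes x hf)); move: h xp.
  by case: (ltgtP p x) => //= _ + _; rewrite (inj_eq (addIr _)).
move=> [->|vx]; apply/(verticesE (slopes_at_bend p w _ hf)).
  by rewrite ltxx lexx addr0 (not_vertex hf vp) eq_sym -subr_eq0 addrC addKr.
have xp : x != p by apply: contra_notN vp => /eqP <-.
move/(verticesE (cpl_slopes x hf)): vx xp.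
by case: (ltgtP p x) => //= _ + _; rewrite (inj_eq (addIr _)).
Qed.

Lemma convex_vertices_bend f (p w : R) : cpl f -> ~ vertices f p ->
  convex_vertices (bend f p w) =
  ((if (0 < w)%R then [set p] else set0) `|` convex_vertices f)%classic.
Proof.
move=> hf vp; apply/seteqP; split=> x.
  move/(convex_verticesE (slopes_at_bend p w x hf)) => h.
  have [xp|xp] := eqVneq x p.
    left; move: h; rewrite xp ltxx lexx addr0 (not_vertex hf vp) ltrDl.
    by move=> ->.
  right; apply/(convex_verticesE (cpl_slopes x hf)); move: h xp.
  by case: (ltgtP p x) => //= _ + _; rewrite ltrD2r.
move=> [h|vx]; apply/(convex_verticesE (slopes_at_bend p w _ hf)).
  case: ifP h => // w0 ->.
  by rewrite ltxx lexx addr0 (not_vertex hf vp) ltrDl.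
have xp : x != p.
  by apply: contra_notN vp => /eqP <-; exact: convex_vertices_sub.
move/(convex_verticesE (cpl_slopes x hf)): vx xp.
by case: (ltgtP p x) => //= _ + _; rewrite ltrD2r.
Qed.

Lemma n_vertices_bend f (p w : R) : cpl f -> ~ vertices f p -> w != 0 ->
  n_vertices (bend f p w) = (n_vertices f).+1.
Proof.
move=> hf vp w0; have fv := finite_vertices hf.2.
rewrite /n_vertices vertices_bend // fset_setU1 // cardfsU1 in_fset_set //.
by rewrite (_ : p \in _ = false) //; apply/negP; rewrite inE.
Qed.

Lemma n_convex_bend f (p w : R) : cpl f -> ~ vertices f p ->
  n_convex (bend f p w) = ((0 < w)%R + n_convex f)%N.
Proof.
move=> hf vp; have fv : finite_set (convex_vertices f).
  by apply: sub_finite_set (finite_vertices hf.2); exact: convex_vertices_sub.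
rewrite /n_convex convex_vertices_bend //; case: ifP => _; last by rewrite set0U.
rewrite fset_setU1 // cardfsU1 in_fset_set //.
rewrite (_ : p \in _ = false) //; apply/negP; rewrite inE.
by move/convex_vertices_sub.
Qed.

End Bend.

(** * Growing a pair of functions towards [+oo] *)

Section Growth.
Variable R : realType.
Implicit Types (f g : R -> R) (x y p w M X : R) (n c N : nat).

(** The points of [A] lie strictly before [p] and those of [s] do not, so nothing is counted
    twice. *)
Lemma card_fset_set_ext (A B : set R) p (s : seq R) :
  finite_set B -> (forall x, A x -> x < p) -> (A `<=` B)%classic ->
  uniq s -> (forall x, x \in s -> p <= x /\ B x) ->
  (#|` fset_set A| + size s <= #|` fset_set B|)%N.
Proof.
move=> fB Ap AB us sB; have fA := sub_finite_set AB fB.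
rewrite -size_cat; apply: uniq_leq_size.
  rewrite cat_uniq us andbT fset_uniq /=; apply/hasPn => x /sB[px _].
  by rewrite in_fset_set //; apply/negP; rewrite inE => /Ap; rewrite ltNge px.
move=> x; rewrite mem_cat !in_fset_set // => /orP[|/sB[_ Bx]]; rewrite !inE //.
exact: AB.
Qed.

Lemma env_visible f g x : cpl f -> cpl g -> f x < g x ->
  (vertices (f \min g) x <-> vertices f x) /\
  (convex_vertices (f \min g) x <-> convex_vertices f x).
Proof.
move=> hf hg fg.
have h := slopes_at_min hf.1 hg.1 (cpl_slopes x hf) (cpl_slopes x hg).
rewrite /env_left /env_right subr_lt0 fg in h.
have h' := cpl_slopes x hf; split.
  exact: (iff_trans (verticesE h) (iff_sym (verticesE h'))).
exact: (iff_trans (convex_verticesE h) (iff_sym (convex_verticesE h'))).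
Qed.

Lemma env_transversal f g (a b a' b' u v : R) X : cpl f -> cpl g ->
  {in `]u, v[, forall t, f t = a * t + b} ->
  {in `]u, v[, forall t, g t = a' * t + b'} ->
  u < X < v -> f X = g X -> a != a' -> vertices (f \min g) X.
Proof.
move=> hf hg ef eg uXv e aa'; have [uX Xv] := andP uXv.
have subl : {subset `]u, X[ <= `]u, v[}.
  by move=> t; rewrite !in_itv /= => /andP[-> /lt_trans ->].
have subr : {subset `]X, v[ <= `]u, v[}.
  by move=> t; rewrite !in_itv /= => /andP[/(lt_trans uX) -> ->].
have hl := slopes_at_affine hf.1 uXv
  (fun t ht => ef t (subl t ht)) (fun t ht => ef t (subr t ht)).
have hr := slopes_at_affine hg.1 uXv
  (fun t ht => eg t (subl t ht)) (fun t ht => eg t (subr t ht)).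
apply/(verticesE (slopes_at_min hf.1 hg.1 hl hr)).
rewrite e subrr /env_left /env_right ltxx.
by case: (ltgtP a a') aa' => //= h _; rewrite gt_eqF.
Qed.

(** The old envelope has no vertex from [p] on and is unchanged before [p], so every vertex
    exhibited from [p] on is a gain. *)
Lemma env_extension f g f' g' p (s sc : seq R) :
  cpl f -> cpl g -> cpl f' -> cpl g' ->
  (forall x, x <= p -> f' x = f x) -> (forall x, x <= p -> g' x = g x) ->
  (forall x, p <= x -> f x < g x /\ ~ vertices f x) ->
  uniq s -> (forall x, x \in s -> p <= x /\ vertices (f' \min g') x) ->
  uniq sc -> (forall x, x \in sc -> p <= x /\ convex_vertices (f' \min g') x) ->
  (n_vertices (f \min g) + size s <= n_vertices (f' \min g'))%N /\
  (n_convex (f \min g) + size sc <= n_convex (f' \min g'))%N.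
Proof.
move=> hf hg hf' hg' ef eg hp us hs usc hsc.
have fin := finite_env_vertices hf' hg'.
have lt x : vertices (f \min g) x -> x < p.
  move=> vx; rewrite ltNge; apply/negP => /hp[fg]; apply.
  by apply/(env_visible hf hg fg).1.
have ext x l r : x < p -> slopes_at (f \min g) x l r ->
    slopes_at (f' \min g') x l r.
  move=> xp; apply: (@slopes_at_ext _ _ _ _ (x - 1) p); first by rewrite xp andbT; lra.
  by move=> t; rewrite in_itv /= => /andP[_ /ltW tp]; rewrite ef ?eg.
split; apply: (card_fset_set_ext (p := p)) => //.
- by move=> x vx; have xp := lt x vx; case: vx => l [r [/(ext _ _ _ xp) h lr]]; exists l, r.
- by apply: sub_finite_set fin; exact: convex_vertices_sub.
- by move=> x /convex_vertices_sub; exact: lt.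
- move=> x vx; have xp := lt x (convex_vertices_sub vx).
  by case: vx => l [r [/(ext _ _ _ xp) h lr]]; exists l, r.
Qed.

Definition has_counts f n c := [/\ cpl f, n_vertices f = n & n_convex f = c].

Definition affine_from M (a b : R) f := forall x, M <= x -> f x = a * x + b.

(* [f1] is the function that is eventually the smaller one, and the gap to [f2]
   grows, so that a later vertex may or may not cause a further crossing. *)
Definition realizable n1 c1 n2 c2 N := exists f1 f2 M (a1 b1 a2 b2 : R),
  [/\ has_counts f1 n1 c1, has_counts f2 n2 c2,
      [/\ affine_from M a1 b1 f1, affine_from M a2 b2 f2, a1 < a2 &
          a1 * M + b1 < a2 * M + b2] &
      (N <= n_vertices (f1 \min f2))%N /\ (c1 + c2 <= n_convex (f1 \min f2))%N].

Lemma has_counts_bend f n c p w : has_counts f n c -> ~ vertices f p -> w != 0 ->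
  has_counts (bend f p w) n.+1 ((0 < w)%R + c)%N.
Proof.
move=> [hf hn hc] vp w0; split; first exact: cpl_bend.
  by rewrite n_vertices_bend // hn.
by rewrite n_convex_bend // hc.
Qed.

Lemma slopes_at_affine_from M (a b : R) f x : cpl f -> affine_from M a b f -> M < x ->
  slopes_at f x a a.
Proof.
move=> hf h Mx; have e : M < x < x + 1 by rewrite Mx; lra.
apply: (slopes_at_affine hf.1 e) => t; rewrite in_itv /= => /andP[ht _];
  by apply: h; rewrite ltW // (lt_trans Mx).
Qed.

Lemma not_vertex_affine_from M (a b : R) f x : cpl f -> affine_from M a b f ->
  M < x -> ~ vertices f x.
Proof.
by move=> hf h Mx /(verticesE (slopes_at_affine_from hf h Mx)); rewrite eqxx.
Qed.

Lemma bend_id f p w x : x <= p -> bend f p w x = f x.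
Proof. by rewrite /bend /hinge => ->; rewrite addr0. Qed.

Lemma affine_from_bend M (a b : R) f p w : affine_from M a b f -> M <= p ->
  affine_from p (a + w) (b - w * p) (bend f p w).
Proof.
move=> h Mp x px; rewrite /bend h ?(le_trans Mp) // /hinge.
by case: ltgtP px => // [_ _|-> _]; ring.
Qed.

Lemma affine_lt (a b a' b' : R) M x : a < a' -> a * M + b < a' * M + b' -> M <= x ->
  a * x + b < a' * x + b'.
Proof. by move=> aa h Mx; nra. Qed.

Lemma realizable_init : realizable 0 0 0 0 1.
Proof.
have lin (a b : R) : cpl (fun x => a * x + b).
  split; last by exists [::] => i _; exists a, b.
  move=> x; apply: cvgD; last exact: cvg_cst.
  by apply: cvgM; [exact: cvg_cst|exact: cvg_id].
have sl (a b : R) x : slopes_at (fun x => a * x + b) x a a.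
  apply: (@slopes_at_affine_from (x - 1) a b) => //; lra.
have none (a b : R) : has_counts (fun x => a * x + b) 0 0.
  have v0 : vertices (fun x => a * x + b) = set0.
    by apply/seteqP; split=> x // /(verticesE (sl a b x)); rewrite eqxx.
  split; [exact: lin|by rewrite /n_vertices v0 fset_set0|].
  rewrite /n_convex (_ : convex_vertices _ = set0) ?fset_set0 //.
  by apply/seteqP; split=> x // /convex_vertices_sub; rewrite v0.
(* Two lines crossing at [0]: one envelope vertex, with the gap growing afterwards. *)
exists (fun x => -1 * x + 0), (fun x => 1 * x + 0), 1, (-1), 0, 1, 0; split=> //.
  by split => //; lra.
split => //; have fin := finite_env_vertices (lin (-1) 0) (lin 1 0).
rewrite /n_vertices -[1%N]/(size [:: 0 : R]); apply: uniq_leq_size => // x.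
rewrite inE => /eqP ->; rewrite in_fset_set // inE.
apply: (env_transversal (u := -1) (v := 1) (lin _ _) (lin _ _)
  (fun _ _ => erefl) (fun _ _ => erefl)).
- by rewrite ltrN10 ltr01.
- by rewrite !mulr0.
- by apply/eqP; lra.
Qed.

Lemma realizable_stay (convex : bool) n1 c1 n2 c2 N :
  realizable n1 c1 n2 c2 N -> realizable n1.+1 (convex + c1)%N n2 c2 N.+1.
Proof.
move=> [f1 [f2 [M [a1 [b1 [a2 [b2 [h1 h2 [e1 e2 a12 b12] [hN hc]]]]]]]]].
(* A convex bend halves the slope gap and a reflex one widens it; in both cases [f1] stays below
   [f2], so its new vertex is visible. *)
pose w := if convex then (a2 - a1) / 2 else -1; pose p := M + 1.
have Mp : M < p by rewrite ltrDl.
have lt12 x : M <= x -> f1 x < f2 x.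
  by move=> Mx; rewrite e1 // e2 //; exact: (affine_lt a12 b12).
have [k1 _ _] := h1; have [k2 _ _] := h2.
have nv x : M < x -> ~ vertices f1 x by exact: not_vertex_affine_from k1 e1.
have w0 : (0 < w) = convex by rewrite /w; case: (convex); [apply/idP|apply/negP]; lra.
have wn0 : w != 0 by rewrite /w; case: (convex); apply/eqP; lra.
have wlt : a1 + w < a2 by rewrite /w; case: (convex); lra.
have h1' := has_counts_bend h1 (nv _ Mp) wn0; rewrite w0 in h1'.
have [k1' _ _] := h1'.
exists (bend f1 p w), f2, p, (a1 + w), (b1 - w * p), a2, b2; split=> //.
  split=> //; first exact: (affine_from_bend w e1 (ltW Mp)).
    by move=> x px; apply: e2; rewrite (le_trans (ltW Mp)).
  by have := affine_lt a12 b12 (ltW Mp); lra.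
have vis : bend f1 p w p < f2 p by rewrite bend_id // lt12 // ltW.
have [vp cp] := env_visible k1' k2 vis.
have hp x : p <= x -> f1 x < f2 x /\ ~ vertices f1 x.
  move=> px; have Mx : M < x by exact: lt_le_trans px.
  by split; [apply: lt12; exact: ltW|exact: nv].
have sv x : x \in [:: p] -> p <= x /\ vertices (bend f1 p w \min f2) x.
  rewrite inE => /eqP ->; split=> //; apply/vp.
  by rewrite vertices_bend //; [left|exact: nv].
have sc x : x \in (if convex then [:: p] else [::]) ->
    p <= x /\ convex_vertices (bend f1 p w \min f2) x.
  case E: convex => //; rewrite inE => /eqP ->; split=> //; apply/cp.
  by rewrite convex_vertices_bend //; [rewrite w0 E; left|exact: nv].
have usc : uniq (if convex then [:: p] else [::]) by case: (convex).
have [] := env_extension k1 k2 k1' k2 (fun x => @bend_id f1 p w x)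
  (fun _ _ => erefl) hp (erefl : uniq [:: p]) sv usc sc.
move=> /= g1 g2; split; [move: hN g1|move: hc g2; case: (convex) => /=];
  clear; lia.
Qed.

(* A bend of twice the slope gap turns the growth of the gap into a decay at
   the same rate, so that the functions cross once more. *)
Lemma realizable_cross (upper : bool) n1 c1 n2 c2 N :
  realizable n1 c1 n2 c2 N ->
  if upper then realizable n2.+1 c2 n1 c1 N.+1
  else realizable n2 c2 n1.+1 c1.+1 N.+2.
Proof.
move=> [f1 [f2 [M [a1 [b1 [a2 [b2 [h1 h2 [e1 e2 a12 b12] [hN hc]]]]]]]]].
pose e := a2 - a1; have e0 : 0 < e by rewrite subr_gt0.
pose p := M + 1; have Mp : M < p by rewrite ltrDl.
have lt12 x : M <= x -> f1 x < f2 x.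
  by move=> Mx; rewrite e1 // e2 //; exact: (affine_lt a12 b12).
have [k1 _ _] := h1; have [k2 _ _] := h2.
have nv1 x : M < x -> ~ vertices f1 x by exact: not_vertex_affine_from k1 e1.
have nv2 x : M < x -> ~ vertices f2 x by exact: not_vertex_affine_from k2 e2.
have hp x : p <= x -> f1 x < f2 x /\ ~ vertices f1 x.
  move=> px; have Mx : M < x by exact: lt_le_trans px.
  by split; [apply: lt12; exact: ltW|exact: nv1].
(* The gap at [p] divided by its rate of decay [e]: the crossing is at [X = p + h], and from [X + 1]
   on the new order is strict. *)
pose h := (a2 * p + b2 - (a1 * p + b1)) / e.
have h0 : 0 < h by rewrite divr_gt0 // subr_gt0 (affine_lt a12 b12) // ltW.
have hE : h * e = a2 * p + b2 - (a1 * p + b1) by rewrite divfK // gt_eqF.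
pose X := p + h; have pX : p < X by rewrite ltrDl.
have pX1 : p < X < X + 1 by rewrite pX ltrDl ltr01.
have MX1 : M <= X + 1 by lra.
have itv f (a b : R) : affine_from p a b f -> {in `]p, X + 1[, forall t, f t = a * t + b}.
  by move=> q t; rewrite in_itv /= => /andP[/ltW pt _]; exact: q.
have q1 : affine_from p a1 b1 f1 by move=> x px; apply: e1; lra.
have q2 : affine_from p a2 b2 f2 by move=> x px; apply: e2; lra.
case: upper.
(* The upper function bends down: its reflex vertex is hidden, so the crossing is the only gain. *)
- pose w := - (2 * e); have wn0 : w != 0 by rewrite /w; apply/eqP; lra.
  have := has_counts_bend h2 (nv2 _ Mp) wn0.
  have -> : (0 < w) = false by rewrite /w; apply/negP; lra.
  rewrite add0n => h2'; have [k2' _ _] := h2'.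
  have q2' := affine_from_bend w q2 (lexx p).
  exists (bend f2 p w), f1, (X + 1), (a2 + w), (b2 - w * p), a1, b1; split=> //.
    split=> [x px|x px||]; [by apply: q2'; lra|by apply: e1; lra| |].
      by rewrite /w /e; lra.
    by move: hE e0; rewrite /w /X /e; nra.
  have -> : bend f2 p w \min f1 = f1 \min bend f2 p w.
    by apply/funext => x; rewrite /= minC.
  have sv x : x \in [:: X] -> p <= x /\ vertices (f1 \min bend f2 p w) x.
    rewrite inE => /eqP ->; split; first exact: ltW.
    apply: (env_transversal k1 k2' (itv _ _ _ q1) (itv _ _ _ q2') pX1).
      by rewrite q1 ?(ltW pX) // q2' ?(ltW pX) // /X /w; move: hE; rewrite /e; lra.
    by apply/eqP; rewrite /w /e; lra.
  have sc x : x \in [::] -> p <= x /\ convex_vertices (f1 \min bend f2 p w) x by [].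
  have [] := env_extension k1 k2 k1 k2' (fun _ _ => erefl)
    (fun x => @bend_id f2 p w x) hp (erefl : uniq [:: X]) sv (erefl : uniq [::]) sc.
  by move=> /= g1 g2; split; [apply: leq_trans g1; move: hN|
    apply: leq_trans g2; move: hc]; clear; lia.
(* The lower function bends up: its convex vertex is visible and a crossing follows, a gain of
   two. *)
- pose w := 2 * e; have wn0 : w != 0 by rewrite /w; apply/eqP; lra.
  have := has_counts_bend h1 (nv1 _ Mp) wn0.
  have w0 : 0 < w by rewrite /w; lra.
  rewrite w0 add1n => h1'; have [k1' _ _] := h1'.
  have q1' := affine_from_bend w q1 (lexx p).
  exists f2, (bend f1 p w), (X + 1), a2, b2, (a1 + w), (b1 - w * p); split=> //.
    split=> [x px|x px||]; [by apply: e2; lra|by apply: q1'; lra| |].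
      by rewrite /w /e; lra.
    by move: hE e0; rewrite /w /X /e; nra.
  have -> : f2 \min bend f1 p w = bend f1 p w \min f2.
    by apply/funext => x; rewrite /= minC.
  have vis : bend f1 p w p < f2 p by rewrite bend_id // lt12 // ltW.
  have [vp cp] := env_visible k1' k2 vis.
  have upX : uniq [:: p; X] by rewrite /= inE lt_eqF.
  have sv x : x \in [:: p; X] -> p <= x /\ vertices (bend f1 p w \min f2) x.
    rewrite !inE => /orP[] /eqP ->.
      by split=> //; apply/vp; rewrite vertices_bend //; [left|exact: nv1].
    split; first exact: ltW.
    apply: (env_transversal k1' k2 (itv _ _ _ q1') (itv _ _ _ q2) pX1).
      by rewrite q2 ?(ltW pX) // q1' ?(ltW pX) // /X /w; move: hE; rewrite /e; lra.
    by apply/eqP; rewrite /w /e; lra.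
  have sc x : x \in [:: p] -> p <= x /\ convex_vertices (bend f1 p w \min f2) x.
    rewrite inE => /eqP ->; split=> //; apply/cp.
    by rewrite convex_vertices_bend //; [rewrite w0; left|exact: nv1].
  have [] := env_extension k1 k2 k1' k2 (fun x => @bend_id f1 p w x)
    (fun _ _ => erefl) hp upX sv (erefl : uniq [:: p]) sc.
  by move=> /= g1 g2; split; [apply: leq_trans g1; move: hN|
    apply: leq_trans g2; move: hc]; clear; lia.
Qed.

End Growth.

(** * Combining the moves into extremal pairs *)

Section Tightness.
Local Open Scope nat_scope.
Variable R : realType.
Implicit Types n c k N : nat.
Local Notation realizable := (@realizable R).

(** Which function ends up lower depends on the number of crossings; the symmetry of the minimum
    makes both outcomes acceptable. *)
Definition realizable_sym n1 c1 n2 c2 N :=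
  realizable n1 c1 n2 c2 N \/ realizable n2 c2 n1 c1 N.

Lemma realizable_eq n1 c1 n2 c2 N n1' c1' n2' c2' N' :
  realizable n1 c1 n2 c2 N ->
  n1 = n1' -> c1 = c1' -> n2 = n2' -> c2 = c2' -> N = N' ->
  realizable n1' c1' n2' c2' N'.
Proof. by move=> h <- <- <- <- <-. Qed.

Lemma realizable_stays (convex : bool) k n1 c1 n2 c2 N :
  realizable n1 c1 n2 c2 N ->
  realizable (n1 + k) (c1 + convex * k) n2 c2 (N + k).
Proof.
elim: k => [|k ih] h; first by apply: (realizable_eq h); lia.
by apply: (realizable_eq (realizable_stay convex (ih h))); lia.
Qed.

(** Each round bends both functions convexly in turn, every bend being visible and causing a
    crossing. *)
Lemma realizable_alternate k n1 c1 n2 c2 N : realizable n1 c1 n2 c2 N ->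
  realizable (n1 + k) (c1 + k) (n2 + k) (c2 + k) (N + 4 * k).
Proof.
elim: k => [|k ih] h; first by apply: (realizable_eq h); lia.
have h' := realizable_cross false (realizable_cross false (ih h)).
by apply: (realizable_eq h'); lia.
Qed.

(** Each round spends on [f2] a hidden reflex bend that crosses down, then a visible convex one that
    crosses back: three vertices for two bends. *)
Lemma realizable_zigzag k n1 c1 n2 c2 N : realizable n1 c1 n2 c2 N ->
  realizable n1 c1 (n2 + 2 * k) (c2 + k) (N + 3 * k).
Proof.
elim: k => [|k ih] h; first by apply: (realizable_eq h); lia.
have h' := realizable_cross false (realizable_cross true (ih h)).
by apply: (realizable_eq h'); lia.
Qed.

(** The first reflex bend is hidden but brings its function below; the others are then visible. Each
    gains one vertex. *)
Lemma realizable_upper k n1 c1 n2 c2 N : realizable n1 c1 n2 c2 N ->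
  realizable_sym n1 c1 (n2 + k) c2 (N + k).
Proof.
case: k => [|k] h; [left|right]; first by apply: (realizable_eq h); lia.
have h' := realizable_stays false k (realizable_cross true h).
by apply: (realizable_eq h'); lia.
Qed.

Lemma realizable_tight n1 n2 c1 c2 :
  (c1 <= n1) -> (c2 <= n2) -> (c1 <= c2) ->
  realizable_sym n1 c1 n2 c2
    (n1 + n2 + 1 + minn (2 * c1 + n2 - c2 + 1) (c1 + c2)).
Proof.
move=> h1 h2; rewrite leq_eqVlt => /predU1P[e|h12].
  (* With [c1 = c2] the minimum is [c1 + c2], so every convex vertex can be used for alternation. *)
  have base := realizable_stays false (n1 - c1) (realizable_init R).
  have [/(realizable_alternate c1) h|/(realizable_alternate c1) h] :=
    realizable_upper (n2 - c2) base; [left|right];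
  by apply: (realizable_eq h); lia.
(* Of the [c2 - c1] surplus convex vertices of [f2], [m] bend without crossing, one crosses so that
   [f1] becomes the lower function, and [k] are used in zigzags, each of which also consumes a
   reflex vertex of [f2]. *)
pose k := minn (n2 - c2) (c2 - c1 - 1); pose m := (c2 - c1 - 1 - k).
have base := realizable_stays true m (realizable_init R).
have {}base := realizable_alternate c1 (realizable_cross false base).
have {}base := realizable_stays false (n1 - c1) (realizable_zigzag k base).
have [h|h] := realizable_upper (n2 - c2 - k) base; [left|right];
  by apply: (realizable_eq h); lia.
Qed.

End Tightness.

Theorem theorem1 (R : realType) (n1 n2 c1 c2 : nat)
    (h1 : (c1 <= n1)%N) (h2 : (c2 <= n2)%N) (h12 : (c1 <= c2)%N) :
  (forall f1 f2 : R -> R,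
    continuous f1 -> piecewise_linear f1 ->
    n_vertices f1 = n1 -> n_convex f1 = c1 ->
    continuous f2 -> piecewise_linear f2 ->
    n_vertices f2 = n2 -> n_convex f2 = c2 ->
    (n_vertices (f1 \min f2)
       <= n1 + n2 + 1 + minn (2 * c1 + n2 - c2 + 1) (c1 + c2))%N /\
    (n_convex (f1 \min f2) <= c1 + c2)%N) /\
  (exists f1 f2 : R -> R,
    [/\ continuous f1, piecewise_linear f1,
        n_vertices f1 = n1 & n_convex f1 = c1] /\
    [/\ continuous f2, piecewise_linear f2,
        n_vertices f2 = n2 & n_convex f2 = c2] /\
    n_vertices (f1 \min f2)
      = (n1 + n2 + 1 + minn (2 * c1 + n2 - c2 + 1) (c1 + c2))%N /\
    n_convex (f1 \min f2) = (c1 + c2)%N).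
Proof.
have upper (f1 f2 : R -> R) : has_counts f1 n1 c1 -> has_counts f2 n2 c2 ->
    (n_vertices (f1 \min f2)
       <= n1 + n2 + 1 + minn (2 * c1 + n2 - c2 + 1) (c1 + c2))%N /\
    (n_convex (f1 \min f2) <= c1 + c2)%N.
  move=> [k1 en1 ec1] [k2 en2 ec2]; have [] := env_upper_bounds k1 k2.
  rewrite en1 en2 ec1 ec2 => b0 b1 b2.
  (* [b1] yields the term [c1 + c2] and [b2] the other one; [h2] ensures that subtracting [c2] does
     not truncate. *)
  by split=> //; move: h2 b1 b2; clear; lia.
split=> [f1 f2 cf1 pf1 en1 ec1 cf2 pf2 en2 ec2|]; first exact: upper.
have final (f1 f2 : R -> R) : has_counts f1 n1 c1 -> has_counts f2 n2 c2 ->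
    (n1 + n2 + 1 + minn (2 * c1 + n2 - c2 + 1) (c1 + c2)
       <= n_vertices (f1 \min f2))%N ->
    (c1 + c2 <= n_convex (f1 \min f2))%N ->
    [/\ continuous f1, piecewise_linear f1,
        n_vertices f1 = n1 & n_convex f1 = c1] /\
    [/\ continuous f2, piecewise_linear f2,
        n_vertices f2 = n2 & n_convex f2 = c2] /\
    n_vertices (f1 \min f2)
      = (n1 + n2 + 1 + minn (2 * c1 + n2 - c2 + 1) (c1 + c2))%N /\
    n_convex (f1 \min f2) = (c1 + c2)%N.
  move=> k1 k2 bn bc; have [un uc] := upper f1 f2 k1 k2.
  have [[cf1 pf1] en1 ec1] := k1; have [[cf2 pf2] en2 ec2] := k2.
  by do 3?split=> //; apply/eqP; rewrite eqn_leq ?un ?uc.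
have [] := realizable_tight R h1 h2 h12;
  move=> [f1 [f2 [M [a1 [b1 [a2 [b2 [k1 k2 _ [bn bc]]]]]]]]].
  by exists f1, f2; exact: final.
exists f2, f1; have e : f2 \min f1 = f1 \min f2.
  by apply/funext => x; rewrite /= minC.
by apply: final; rewrite // e // addnC.
Qed.
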